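(* For $m,n\in\mathbb N$ let $\mathcal H_{m,n}$ denote the (Hamiltonian) variety of all $\mathrm e$-cyclic residuated lattices satisfying the identities $(x\wedge \mathrm e)^m\le\lambda_y(x)$ and $(x\wedge \mathrm e)^n\le\rho_y(x)$. Then the map $\langle m,n\rangle\mapsto\mathcal H_{m,n}$ is an order-embedding of $(\mathbb N^2,\le)$ (with the componentwise order) into the lattice of Hamiltonian varieties of $\mathrm e$-cyclic residuated lattices (ordered by inclusion). In particular, there is no largest Hamiltonian variety of $\mathrm e$-cyclic residuated lattices.
   Context: A residuated lattice is an algebra $\mathbf L=(L,\cdot,\backslash,/,\vee,\wedge,\mathrm e)$ such that $(L,\cdot,\mathrm e)$ is a monoid, $(L,\vee,\wedge)$ is a lattice with order $\le$, and $x\cdot y\le z \iff y\le x\backslash z \iff x\le z/y$ for all $x,y,z\in L$. It is $\mathrm e$-cyclic if $\mathrm e/x=x\backslash \mathrm e$ for all $x\in L$. $\mathbb N$ is the set of positive integers. Notation: $\lambda_y(x)=(y\backslash xy)\wedge \mathrm e$, $\rho_y(x)=(yx/y)\wedge \mathrm e$. A convex subalgebra of $\mathbf L$ is a subalgebra (closed under all operations, containing $\mathrm e$) whose universe is order-convex; a convex subalgebra $H$ is normal if $\lambda_y(x)\in H$ and $\rho_y(x)\in H$ for all $x\in H$, $y\in L$. An $\mathrm e$-cyclic residuated lattice is Hamiltonian if all its convex subalgebras are normal; a variety is Hamiltonian if all its members are Hamiltonian. An order-embedding is a map $f$ with $p\le q\iff f(p)\le f(q)$. *)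

(* Defs.v *)
Set Implicit Arguments.
Unset Strict Implicit.
Unset Printing Implicit Defensive.

(* Algebras are on arbitrary types with Leibniz equality; the order is a
   proposition, so no decidability or choice structure is imposed on carriers. *)
Record rl_algebra : Type := RLAlgebra {
  rl_car :> Type;
  rl_mul : rl_car -> rl_car -> rl_car;
  rl_ldiv : rl_car -> rl_car -> rl_car; (* rl_ldiv x y is x\y *)
  rl_rdiv : rl_car -> rl_car -> rl_car; (* rl_rdiv x y is x/y *)
  rl_join : rl_car -> rl_car -> rl_car;
  rl_meet : rl_car -> rl_car -> rl_car;
  rl_e : rl_car
}.
Arguments rl_e {_}.

Definition rl_le (L : rl_algebra) (x y : L) : Prop := rl_meet x y = x.

Record residuated_lattice (L : rl_algebra) : Prop := ResiduatedLattice {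
  rl_mulA : forall x y z : L, rl_mul x (rl_mul y z) = rl_mul (rl_mul x y) z;
  rl_mul1l : forall x : L, rl_mul rl_e x = x;
  rl_mul1r : forall x : L, rl_mul x rl_e = x;
  rl_joinC : forall x y : L, rl_join x y = rl_join y x;
  rl_meetC : forall x y : L, rl_meet x y = rl_meet y x;
  rl_joinA : forall x y z : L,
    rl_join x (rl_join y z) = rl_join (rl_join x y) z;
  rl_meetA : forall x y z : L,
    rl_meet x (rl_meet y z) = rl_meet (rl_meet x y) z;
  rl_joinK : forall x y : L, rl_meet x (rl_join x y) = x;
  rl_meetK : forall x y : L, rl_join x (rl_meet x y) = x;
  rl_ldivP : forall x y z : L,
    rl_le (rl_mul x y) z <-> rl_le y (rl_ldiv x z);
  rl_rdivP : forall x y z : L,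
    rl_le (rl_mul x y) z <-> rl_le x (rl_rdiv z y)
}.

Definition e_cyclic (L : rl_algebra) : Prop :=
  forall x : L, rl_rdiv rl_e x = rl_ldiv x rl_e.

Definition e_cyclic_rl (L : rl_algebra) : Prop :=
  residuated_lattice L /\ e_cyclic L.

Fixpoint rl_exp (L : rl_algebra) (x : L) (n : nat) : L :=
  match n with
  | O => rl_e
  | S k => rl_mul x (rl_exp x k)
  end.

Definition rl_lambda (L : rl_algebra) (y x : L) : L :=
  rl_meet (rl_ldiv y (rl_mul x y)) rl_e.

Definition rl_rho (L : rl_algebra) (y x : L) : L :=
  rl_meet (rl_rdiv (rl_mul y x) y) rl_e.

Record convex_subalgebra (L : rl_algebra) (H : L -> Prop) : Prop :=
  ConvexSubalgebra {
  csub_e : H rl_e;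
  csub_mul : forall x y, H x -> H y -> H (rl_mul x y);
  csub_ldiv : forall x y, H x -> H y -> H (rl_ldiv x y);
  csub_rdiv : forall x y, H x -> H y -> H (rl_rdiv x y);
  csub_join : forall x y, H x -> H y -> H (rl_join x y);
  csub_meet : forall x y, H x -> H y -> H (rl_meet x y);
  csub_convex : forall x y z, H x -> H z -> rl_le x y -> rl_le y z -> H y
}.

Definition normal (L : rl_algebra) (H : L -> Prop) : Prop :=
  forall x y : L, H x -> H (rl_lambda y x) /\ H (rl_rho y x).

Definition hamiltonian (L : rl_algebra) : Prop :=
  forall H : L -> Prop, convex_subalgebra H -> normal H.

Inductive rl_term : Type :=
| TVar : nat -> rl_term
| TE : rl_term
| TMul : rl_term -> rl_term -> rl_term
| TLdiv : rl_term -> rl_term -> rl_term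
| TRdiv : rl_term -> rl_term -> rl_term
| TJoin : rl_term -> rl_term -> rl_term
| TMeet : rl_term -> rl_term -> rl_term.

Fixpoint rl_eval (L : rl_algebra) (v : nat -> L) (t : rl_term) : L :=
  match t with
  | TVar i => v i
  | TE => rl_e
  | TMul s u => rl_mul (rl_eval v s) (rl_eval v u)
  | TLdiv s u => rl_ldiv (rl_eval v s) (rl_eval v u)
  | TRdiv s u => rl_rdiv (rl_eval v s) (rl_eval v u)
  | TJoin s u => rl_join (rl_eval v s) (rl_eval v u)
  | TMeet s u => rl_meet (rl_eval v s) (rl_eval v u)
  end.

Definition rl_satisfies (L : rl_algebra) (s t : rl_term) : Prop :=
  forall v : nat -> L, rl_eval v s = rl_eval v t.

Definition rl_class : Type := rl_algebra -> Prop.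

Definition class_sub (K K' : rl_class) : Prop := forall L, K L -> K' L.

(* A variety is an equational class; E is the set of defining identities. *)
Definition variety (K : rl_class) : Prop :=
  exists E : rl_term -> rl_term -> Prop,
    forall L, K L <-> (forall s t, E s t -> rl_satisfies L s t).

Definition hamiltonian_variety (K : rl_class) : Prop :=
  variety K /\ class_sub K e_cyclic_rl /\ class_sub K hamiltonian.

Definition Hclass (m n : nat) : rl_class := fun L =>
  e_cyclic_rl L /\
  (forall x y : L, rl_le (rl_exp (rl_meet x rl_e) m) (rl_lambda y x)) /\
  (forall x y : L, rl_le (rl_exp (rl_meet x rl_e) n) (rl_rho y x)).

(* Main.v *)
(** Integral examples cannot separate H_{m,1} from H_{1,1}, since [x y <= y x]
    for all [x], [y] forces commutativity.  The separating algebra is the chain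
      0 < ... < x^2 < x < e < ... < y x^2 < y x < y < T
    with [x y = y x^m], in which a product of two elements of the block [y x^j]
    is [T].  It lies in H_{m,1}, but [y x^p <= x y] only if [m <= p]; its
    opposite separates the second index.  In the product of these chains over
    all [m], the powers of the sequence of generators [x] are never below the
    conjugate of [x] by [y], although they are coinitial in the negative part
    of the convex subalgebra generated by [x].  So the product is not
    Hamiltonian, although it belongs to every variety containing all H_{m,n}. *)

From Stdlib Require Import PeanoNat Lia FunctionalExtensionality.
Require Import Defs.

(** * Order and residuation *)

Lemma rl_le_refl {L} (HL : residuated_lattice L) (x : L) : rl_le x x.
Proof.
  unfold rl_le. rewrite <- (rl_meetK HL x x) at 2. apply (rl_joinK HL).
Qed.

Lemma rl_le_trans {L} (HL : residuated_lattice L) (y x z : L) :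
  rl_le x y -> rl_le y z -> rl_le x z.
Proof.
  unfold rl_le. intros Hxy Hyz.
  rewrite <- Hxy, <- (rl_meetA HL), Hyz. reflexivity.
Qed.

Lemma rl_le_antisym {L} (HL : residuated_lattice L) (x y : L) :
  rl_le x y -> rl_le y x -> x = y.
Proof.
  unfold rl_le. intros Hxy Hyx. rewrite <- Hxy, (rl_meetC HL). exact Hyx.
Qed.

Lemma rl_meet_lel {L} (HL : residuated_lattice L) (x y : L) :
  rl_le (rl_meet x y) x.
Proof.
  unfold rl_le. rewrite (rl_meetC HL), (rl_meetA HL).
  f_equal. apply (rl_le_refl HL).
Qed.

Lemma rl_meet_ler {L} (HL : residuated_lattice L) (x y : L) :
  rl_le (rl_meet x y) y.
Proof. rewrite (rl_meetC HL). apply (rl_meet_lel HL). Qed.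

Lemma rl_le_meet {L} (HL : residuated_lattice L) (x y z : L) :
  rl_le z (rl_meet x y) <-> rl_le z x /\ rl_le z y.
Proof.
  split.
  - intros H. split; apply (rl_le_trans HL _ _ _ H);
      [apply (rl_meet_lel HL) | apply (rl_meet_ler HL)].
  - unfold rl_le. intros [Hx Hy]. rewrite (rl_meetA HL), Hx. exact Hy.
Qed.

Lemma rl_le_join_eq {L} (HL : residuated_lattice L) (x y : L) :
  rl_le x y <-> rl_join x y = y.
Proof.
  unfold rl_le. split; intros H.
  - rewrite <- H, (rl_joinC HL), (rl_meetC HL). apply (rl_meetK HL).
  - rewrite <- H. apply (rl_joinK HL).
Qed.

Lemma rl_le_joinl {L} (HL : residuated_lattice L) (x y : L) :
  rl_le x (rl_join x y).
Proof. apply (rl_joinK HL). Qed.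

Lemma rl_join_le {L} (HL : residuated_lattice L) (x y z : L) :
  rl_le x z -> rl_le y z -> rl_le (rl_join x y) z.
Proof.
  rewrite !(rl_le_join_eq HL). intros Hx Hy.
  rewrite <- (rl_joinA HL), Hy. exact Hx.
Qed.

Lemma rl_mul_monor {L} (HL : residuated_lattice L) (x y z : L) :
  rl_le y z -> rl_le (rl_mul x y) (rl_mul x z).
Proof.
  intros H. apply (rl_ldivP HL), (rl_le_trans HL z _ _ H).
  apply (rl_ldivP HL), (rl_le_refl HL).
Qed.

Lemma rl_mul_monol {L} (HL : residuated_lattice L) (x y z : L) :
  rl_le y z -> rl_le (rl_mul y x) (rl_mul z x).
Proof.
  intros H. apply (rl_rdivP HL), (rl_le_trans HL z _ _ H).
  apply (rl_rdivP HL), (rl_le_refl HL).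
Qed.

Lemma rl_mul_mono {L} (HL : residuated_lattice L) (x x' y y' : L) :
  rl_le x x' -> rl_le y y' -> rl_le (rl_mul x y) (rl_mul x' y').
Proof.
  intros Hx Hy. apply (rl_le_trans HL (rl_mul x y')).
  - apply (rl_mul_monor HL), Hy.
  - apply (rl_mul_monol HL), Hx.
Qed.

Lemma rl_mul_decrr {L} (HL : residuated_lattice L) (x y : L) :
  rl_le y rl_e -> rl_le (rl_mul x y) x.
Proof.
  intros H. pose proof (rl_mul_monor HL x _ _ H) as Hxy.
  rewrite (rl_mul1r HL) in Hxy. exact Hxy.
Qed.

Lemma rl_mul_decrl {L} (HL : residuated_lattice L) (x y : L) :
  rl_le y rl_e -> rl_le (rl_mul y x) x.
Proof.
  intros H. pose proof (rl_mul_monol HL x _ _ H) as Hxy.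
  rewrite (rl_mul1l HL) in Hxy. exact Hxy.
Qed.

Lemma rl_mul_ldiv {L} (HL : residuated_lattice L) (x y : L) :
  rl_le (rl_mul x (rl_ldiv x y)) y.
Proof. apply (rl_ldivP HL), (rl_le_refl HL). Qed.

Lemma rl_mul_rdiv {L} (HL : residuated_lattice L) (x y : L) :
  rl_le (rl_mul (rl_rdiv y x) x) y.
Proof. apply (rl_rdivP HL), (rl_le_refl HL). Qed.

(** In this form e-cyclicity can be tested on products alone, and it lets a factor pass to the other
    side of an inequality with bound [e]. *)
Lemma e_cyclic_mul {L} (HL : residuated_lattice L) :
  e_cyclic L <->
  forall x y : L, rl_le (rl_mul x y) rl_e <-> rl_le (rl_mul y x) rl_e.
Proof.
  split.
  - intros HC x y. rewrite (rl_ldivP HL), (rl_rdivP HL), HC. tauto.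
  - intros HC x. apply (rl_le_antisym HL).
    + apply (rl_ldivP HL), HC, (rl_mul_rdiv HL).
    + apply (rl_rdivP HL), HC, (rl_mul_ldiv HL).
Qed.

(** A negative lower bound makes the meet with [e] harmless, and residuation then removes the
    division, so conjugates never have to be computed. *)
Lemma le_rl_lambda {L} (HL : residuated_lattice L) (x y z : L) :
  rl_le z rl_e ->
  rl_le z (rl_lambda y x) <-> rl_le (rl_mul y z) (rl_mul x y).
Proof.
  intros Hz. unfold rl_lambda. rewrite (rl_le_meet HL), (rl_ldivP HL). tauto.
Qed.

Lemma le_rl_rho {L} (HL : residuated_lattice L) (x y z : L) :
  rl_le z rl_e ->
  rl_le z (rl_rho y x) <-> rl_le (rl_mul z y) (rl_mul y x).
Proof.
  intros Hz. unfold rl_rho. rewrite (rl_le_meet HL), (rl_rdivP HL). tauto.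
Qed.

(** * Powers *)

Lemma rl_exp_add {L} (HL : residuated_lattice L) (x : L) (j k : nat) :
  rl_exp x (j + k) = rl_mul (rl_exp x j) (rl_exp x k).
Proof.
  induction j as [|j IH]; simpl.
  - symmetry. apply (rl_mul1l HL).
  - rewrite IH. apply (rl_mulA HL).
Qed.

Lemma rl_exp_le_e {L} (HL : residuated_lattice L) (x : L) (k : nat) :
  rl_le x rl_e -> rl_le (rl_exp x k) rl_e.
Proof.
  intros Hx. induction k as [|k IH]; simpl.
  - apply (rl_le_refl HL).
  - apply (rl_le_trans HL x); [apply (rl_mul_decrr HL)|]; assumption.
Qed.

Lemma rl_exp_anti {L} (HL : residuated_lattice L) (x : L) (j k : nat) :
  rl_le x rl_e -> j <= k -> rl_le (rl_exp x k) (rl_exp x j).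
Proof.
  intros Hx Hjk. replace k with (j + (k - j)) by lia.
  rewrite (rl_exp_add HL).
  apply (rl_mul_decrr HL), (rl_exp_le_e HL), Hx.
Qed.

Lemma csub_exp {L : rl_algebra} (H : L -> Prop) (x : L) (k : nat) :
  convex_subalgebra H -> H x -> H (rl_exp x k).
Proof.
  intros HH Hx. induction k as [|k IH]; simpl.
  - apply (csub_e HH).
  - apply (csub_mul HH); assumption.
Qed.

(** Each conjugate of [x] is squeezed between a power of [x /\ e], which lies in [H], and [e];
    convexity finishes. *)
Lemma Hclass_hamiltonian (m n : nat) : class_sub (Hclass m n) hamiltonian.
Proof.
  intros L [[HL _] [Hl Hr]] H HH x y Hx.
  assert (Hxe : H (rl_meet x rl_e)) by (apply (csub_meet HH); [|apply (csub_e HH)]; exact Hx).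
  split.
  - apply (csub_convex HH (csub_exp _ _ m HH Hxe) (csub_e HH)).
    + apply Hl.
    + apply (rl_meet_ler HL).
  - apply (csub_convex HH (csub_exp _ _ n HH Hxe) (csub_e HH)).
    + apply Hr.
    + apply (rl_meet_ler HL).
Qed.

Lemma Hclass_mono (m n p q : nat) :
  m <= p -> n <= q -> class_sub (Hclass m n) (Hclass p q).
Proof.
  intros Hmp Hnq L [[HL HC] [Hl Hr]].
  split; [split; assumption|]. split; intros x y.
  - eapply (rl_le_trans HL); [|apply Hl].
    apply (rl_exp_anti HL); [apply (rl_meet_ler HL) | exact Hmp].
  - eapply (rl_le_trans HL); [|apply Hr].
    apply (rl_exp_anti HL); [apply (rl_meet_ler HL) | exact Hnq].
Qed.

(** * Equational bases *)

Fixpoint TExp (t : rl_term) (k : nat) : rl_term :=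
  match k with
  | O => TE
  | S k => TMul t (TExp t k)
  end.

Lemma rl_eval_TExp {L : rl_algebra} (v : nat -> L) (t : rl_term) (k : nat) :
  rl_eval v (TExp t k) = rl_exp (rl_eval v t) k.
Proof. induction k as [|k IH]; simpl; [|rewrite IH]; reflexivity. Qed.

(* Residuation is equational: [x (x\z /\ y) <= z] and [y <= x\(x y \/ z)]
   together give both directions of [x y <= z <-> y <= x\z]. *)
Inductive Hclass_basis (m n : nat) : rl_term -> rl_term -> Prop :=
| HB_mulA x y z :
    Hclass_basis m n (TMul x (TMul y z)) (TMul (TMul x y) z)
| HB_mul1l x : Hclass_basis m n (TMul TE x) x
| HB_mul1r x : Hclass_basis m n (TMul x TE) x
| HB_joinC x y : Hclass_basis m n (TJoin x y) (TJoin y x)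
| HB_meetC x y : Hclass_basis m n (TMeet x y) (TMeet y x)
| HB_joinA x y z :
    Hclass_basis m n (TJoin x (TJoin y z)) (TJoin (TJoin x y) z)
| HB_meetA x y z :
    Hclass_basis m n (TMeet x (TMeet y z)) (TMeet (TMeet x y) z)
| HB_joinK x y : Hclass_basis m n (TMeet x (TJoin x y)) x
| HB_meetK x y : Hclass_basis m n (TJoin x (TMeet x y)) x
| HB_mul_ldiv x y z :
    Hclass_basis m n (TJoin (TMul x (TMeet (TLdiv x z) y)) z) z
| HB_ldiv_mul x y z :
    Hclass_basis m n (TMeet y (TLdiv x (TJoin (TMul x y) z))) y
| HB_mul_rdiv x y z :
    Hclass_basis m n (TJoin (TMul (TMeet (TRdiv z y) x) y) z) z
| HB_rdiv_mul x y z :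
    Hclass_basis m n (TMeet x (TRdiv (TJoin (TMul x y) z) y)) x
| HB_cyclic x : Hclass_basis m n (TRdiv TE x) (TLdiv x TE)
| HB_lambda x y :
    Hclass_basis m n
      (TMeet (TExp (TMeet x TE) m) (TMeet (TLdiv y (TMul x y)) TE))
      (TExp (TMeet x TE) m)
| HB_rho x y :
    Hclass_basis m n
      (TMeet (TExp (TMeet x TE) n) (TMeet (TRdiv (TMul y x) y) TE))
      (TExp (TMeet x TE) n).

Lemma Hclass_basis_sound (m n : nat) (L : rl_algebra) :
  Hclass m n L -> forall s t, Hclass_basis m n s t -> rl_satisfies L s t.
Proof.
  intros [[HL HC] [Hl Hr]] s t Hst v.
  destruct Hst; cbn [rl_eval]; rewrite ?rl_eval_TExp; cbn [rl_eval].
  - apply (rl_mulA HL).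
  - apply (rl_mul1l HL).
  - apply (rl_mul1r HL).
  - apply (rl_joinC HL).
  - apply (rl_meetC HL).
  - apply (rl_joinA HL).
  - apply (rl_meetA HL).
  - apply (rl_joinK HL).
  - apply (rl_meetK HL).
  - apply (rl_le_join_eq HL), (rl_ldivP HL), (rl_meet_lel HL).
  - apply (rl_ldivP HL), (rl_le_joinl HL).
  - apply (rl_le_join_eq HL), (rl_rdivP HL), (rl_meet_lel HL).
  - apply (rl_rdivP HL), (rl_le_joinl HL).
  - apply HC.
  - apply Hl.
  - apply Hr.
Qed.

Lemma Hclass_basis_complete (m n : nat) (L : rl_algebra) :
  (forall s t, Hclass_basis m n s t -> rl_satisfies L s t) -> Hclass m n L.
Proof.
  intros HE.
  pose (X := TVar 0). pose (Y := TVar 1). pose (Z := TVar 2).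
  pose (v := fun (x y z : L) (i : nat) =>
               match i with 0 => x | 1 => y | _ => z end).
  assert (joinK : forall x y : L, rl_meet x (rl_join x y) = x)
    by (intros x y; exact (HE _ _ (HB_joinK m n X Y) (v x y x))).
  assert (meetK : forall x y : L, rl_join x (rl_meet x y) = x)
    by (intros x y; exact (HE _ _ (HB_meetK m n X Y) (v x y x))).
  assert (meetC : forall x y : L, rl_meet x y = rl_meet y x)
    by (intros x y; exact (HE _ _ (HB_meetC m n X Y) (v x y x))).
  assert (joinC : forall x y : L, rl_join x y = rl_join y x)
    by (intros x y; exact (HE _ _ (HB_joinC m n X Y) (v x y x))).
  assert (le_join : forall x y : L, rl_le x y <-> rl_join x y = y).
  { unfold rl_le. intros x y. split; intros H; rewrite <- H.
    - rewrite joinC, meetC. apply meetK.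
    - apply joinK. }
  split; [split; [constructor|]|split].
  - intros x y z. exact (HE _ _ (HB_mulA m n X Y Z) (v x y z)).
  - intros x. exact (HE _ _ (HB_mul1l m n X) (v x x x)).
  - intros x. exact (HE _ _ (HB_mul1r m n X) (v x x x)).
  - exact joinC.
  - exact meetC.
  - intros x y z. exact (HE _ _ (HB_joinA m n X Y Z) (v x y z)).
  - intros x y z. exact (HE _ _ (HB_meetA m n X Y Z) (v x y z)).
  - exact joinK.
  - exact meetK.
  - intros x y z. split.
    (* The hypothesis [x y <= z] turns [z] into [x y \/ z], which makes the goal an instance of the
       basis. *)
    + rewrite le_join. intros H. rewrite <- H.
      exact (HE _ _ (HB_ldiv_mul m n X Y Z) (v x y z)).
    (* Conversely, [y] is replaced by [x\z /\ y]. *)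
    + intros H. rewrite <- H, meetC. apply le_join.
      exact (HE _ _ (HB_mul_ldiv m n X Y Z) (v x y z)).
  - intros x y z. split.
    + rewrite le_join. intros H. rewrite <- H.
      exact (HE _ _ (HB_rdiv_mul m n X Y Z) (v x y z)).
    + intros H. rewrite <- H, meetC. apply le_join.
      exact (HE _ _ (HB_mul_rdiv m n X Y Z) (v x y z)).
  - intros x. exact (HE _ _ (HB_cyclic m n X) (v x x x)).
  - intros x y. pose proof (HE _ _ (HB_lambda m n X Y) (v x y x)) as H.
    cbn [rl_eval] in H. rewrite !rl_eval_TExp in H. exact H.
  - intros x y. pose proof (HE _ _ (HB_rho m n X Y) (v x y x)) as H.
    cbn [rl_eval] in H. rewrite !rl_eval_TExp in H. exact H.
Qed.

Lemma Hclass_hamiltonian_variety (m n : nat) :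
  hamiltonian_variety (Hclass m n).
Proof.
  split; [|split].
  - exists (Hclass_basis m n). intros L. split.
    + apply Hclass_basis_sound.
    + apply Hclass_basis_complete.
  - intros L [HL _]. exact HL.
  - apply Hclass_hamiltonian.
Qed.

(** * Opposite algebras *)

(** Reversing the product and exchanging the divisions swaps [rl_lambda] and [rl_rho]
    definitionally. *)
Definition rl_op (L : rl_algebra) : rl_algebra :=
  RLAlgebra (fun x y : L => rl_mul y x) (fun x y => rl_rdiv y x)
    (fun x y => rl_ldiv y x) (@rl_join L) (@rl_meet L) rl_e.

Lemma rl_op_residuated (L : rl_algebra) :
  residuated_lattice L -> residuated_lattice (rl_op L).
Proof.
  intros HL. constructor; simpl.
  - intros x y z. symmetry. apply (rl_mulA HL).
  - apply (rl_mul1r HL).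
  - apply (rl_mul1l HL).
  - apply (rl_joinC HL).
  - apply (rl_meetC HL).
  - apply (rl_joinA HL).
  - apply (rl_meetA HL).
  - apply (rl_joinK HL).
  - apply (rl_meetK HL).
  - intros x y z. apply (rl_rdivP HL).
  - intros x y z. apply (rl_ldivP HL).
Qed.

Lemma rl_op_exp {L} (HL : residuated_lattice L) (x : L) (k : nat) :
  @rl_exp (rl_op L) x k = rl_exp x k.
Proof.
  induction k as [|k IH]; [reflexivity|]. simpl. rewrite IH.
  rewrite <- (rl_mul1r HL x) at 2. change (rl_mul x rl_e) with (rl_exp x 1).
  rewrite <- (rl_exp_add HL). rewrite Nat.add_1_r. reflexivity.
Qed.

Lemma Hclass_op (m n : nat) (L : rl_algebra) :
  Hclass m n L -> Hclass n m (rl_op L).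
Proof.
  intros [[HL HC] [Hl Hr]]. split; [split|split].
  - apply rl_op_residuated, HL.
  - intros x. symmetry. apply HC.
  - intros x y. rewrite (rl_op_exp HL). apply Hr.
  - intros x y. rewrite (rl_op_exp HL). apply Hl.
Qed.

(** * The separating chains *)

(* [Pw i] is [x^i], [YPw j] is [y x^j]; larger exponents are lower. *)
Inductive chain : Type :=
| Bot : chain
| Pw : nat -> chain
| YPw : nat -> chain
| Top : chain.

Definition chain_mul (m : nat) (a b : chain) : chain :=
  match a, b with
  | Bot, _ | _, Bot => Bot
  | Pw i, Pw j => Pw (i + j)
  | Pw i, YPw j => YPw (m * i + j)
  | YPw i, Pw j => YPw (i + j)
  | _, _ => Top
  end.

(** Truncated subtraction caps a quotient at the top of its block, [e] or [y]. *)
Definition chain_ldiv (m : nat) (a c : chain) : chain :=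
  match a, c with
  | Bot, _ | _, Top => Top
  | Pw i, Pw k => Pw (k - i)
  | Pw i, YPw k => YPw (k - m * i)
  | YPw i, YPw k => Pw (k - i)
  | _, _ => Bot
  end.

(** For positive [m] this rounds [d / m] up. Since [x^j y x^i <= y x^k] means [k - i <= m * j], the
    greatest such [x^j] has the least such exponent. *)
Definition ceil_div (d m : nat) : nat := (d + (m - 1)) / m.

Definition chain_rdiv (m : nat) (c a : chain) : chain :=
  match a, c with
  | Bot, _ | _, Top => Top
  | Pw i, Pw k => Pw (k - i)
  | Pw i, YPw k => YPw (k - i)
  | YPw i, YPw k => Pw (ceil_div (k - i) m)
  | _, _ => Bot
  end.

Definition chain_join (a b : chain) : chain :=
  match a, b with
  | Bot, c | c, Bot => c
  | Pw i, Pw j => Pw (Nat.min i j)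
  | YPw i, YPw j => YPw (Nat.min i j)
  | Pw _, YPw j | YPw j, Pw _ => YPw j
  | Top, _ | _, Top => Top
  end.

Definition chain_meet (a b : chain) : chain :=
  match a, b with
  | Bot, _ | _, Bot => Bot
  | Pw i, Pw j => Pw (Nat.max i j)
  | YPw i, YPw j => YPw (Nat.max i j)
  | Pw i, YPw _ | YPw _, Pw i => Pw i
  | Top, c | c, Top => c
  end.

Definition chain_rl (m : nat) : rl_algebra :=
  RLAlgebra (chain_mul m) (chain_ldiv m) (chain_rdiv m)
    chain_join chain_meet (Pw 0).

Definition chain_le (a b : chain) : Prop :=
  match a, b with
  | Bot, _ | _, Top => True
  | Pw i, Pw j | YPw i, YPw j => j <= i
  | Pw _, YPw _ => True
  | _, _ => False
  end.

(** Reduces the residuation laws and all later comparisons to arithmetic on exponents. *)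
Lemma chain_leE (m : nat) (a b : chain_rl m) : rl_le a b <-> chain_le a b.
Proof.
  unfold rl_le. destruct a, b; simpl; split; intros H;
    try tauto; try discriminate; try (injection H; lia); f_equal; lia.
Qed.

Lemma ceil_div_le (d m j : nat) :
  1 <= m -> (d <= m * j <-> ceil_div d m <= j).
Proof.
  intros Hm. unfold ceil_div.
  pose proof (Nat.div_mod_eq (d + (m - 1)) m) as Hd.
  pose proof (Nat.mod_upper_bound (d + (m - 1)) m ltac:(lia)) as Hr.
  set (q := (d + (m - 1)) / m) in *. split; nia.
Qed.

Lemma chain_residuated (m : nat) : 1 <= m -> residuated_lattice (chain_rl m).
Proof.
  intros Hm. constructor.
  - intros [] [] []; simpl; try reflexivity; f_equal; lia.
  - intros []; simpl; try reflexivity; f_equal; lia.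
  - intros []; simpl; try reflexivity; f_equal; lia.
  - intros [] []; simpl; try reflexivity; f_equal; lia.
  - intros [] []; simpl; try reflexivity; f_equal; lia.
  - intros [] [] []; simpl; try reflexivity; f_equal; lia.
  - intros [] [] []; simpl; try reflexivity; f_equal; lia.
  - intros [] []; simpl; try reflexivity; f_equal; lia.
  - intros [] []; simpl; try reflexivity; f_equal; lia.
  - intros x y z. rewrite !chain_leE. destruct x, y, z; simpl; lia.
  - intros x y z. rewrite !chain_leE.
    destruct x, y, z; simpl; rewrite <- ?ceil_div_le by exact Hm; lia.
Qed.

(** A product lies below [e] exactly when one factor is [Bot] or both are powers of [x], a condition
    symmetric in the factors. *)
Lemma chain_e_cyclic (m : nat) : 1 <= m -> e_cyclic (chain_rl m).
Proof.
  intros Hm. apply (e_cyclic_mul (chain_residuated m Hm)).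
  intros x y. rewrite !chain_leE. destruct x, y; simpl; lia.
Qed.

Lemma chain_exp_Pw (m i k : nat) :
  @rl_exp (chain_rl m) (Pw i) k = Pw (k * i).
Proof. induction k as [|k IH]; simpl; [|rewrite IH]; reflexivity. Qed.

Lemma chain_exp_Bot (m k : nat) :
  1 <= k -> @rl_exp (chain_rl m) Bot k = Bot.
Proof. destruct k; [lia | reflexivity]. Qed.

Lemma chain_neg (m : nat) (x : chain_rl m) :
  rl_meet x rl_e = Bot \/ exists i, rl_meet x rl_e = Pw i.
Proof.
  destruct x; simpl; eauto.
Qed.

Lemma chain_Hclass (m : nat) : 1 <= m -> Hclass m 1 (chain_rl m).
Proof.
  intros Hm. pose proof (chain_residuated m Hm) as HL.
  assert (neg : forall x k, rl_le (rl_exp (rl_meet x rl_e) k) (@rl_e (chain_rl m)))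
    by (intros x k; apply (rl_exp_le_e HL), (rl_meet_ler HL)).
  split; [split; [exact HL | apply chain_e_cyclic, Hm]|].
  split; intros x y.
  - apply (le_rl_lambda HL); [apply neg|].
    (* By monotonicity [x] may be replaced by [x /\ e], which leaves only [Bot] and the powers of
       the generator. *)
    apply (rl_le_trans HL (rl_mul (rl_meet x rl_e) y));
      [|apply (rl_mul_monol HL), (rl_meet_lel HL)].
    destruct (chain_neg m x) as [-> | [i ->]].
    + rewrite chain_exp_Bot by exact Hm. apply chain_leE. destruct y; exact I.
    (* On the block [y x^j] both sides are equal; on powers of the generator the claim is
       [i <= m * i]. *)
    + rewrite chain_exp_Pw. apply chain_leE. destruct y; simpl; nia.
  - apply (le_rl_rho HL); [apply neg|].
    apply (rl_le_trans HL (rl_mul y (rl_meet x rl_e)));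
      [|apply (rl_mul_monor HL), (rl_meet_lel HL)].
    destruct (chain_neg m x) as [-> | [i ->]].
    + rewrite chain_exp_Bot by lia. apply chain_leE. exact I.
    (* Exponent 1 suffices here: moving [x^i] to the left of [y x^j] only lowers the product, again
       because [i <= m * i]. *)
    + rewrite chain_exp_Pw. apply chain_leE. destruct y; simpl; nia.
Qed.

(** The hypothesis unfolds to [y x^p <= x y = y x^m], and larger exponents are lower. *)
Lemma chain_lambda_sharp (m p : nat) :
  1 <= m ->
  @rl_le (chain_rl m) (@rl_exp (chain_rl m) (Pw 1) p)
    (@rl_lambda (chain_rl m) (YPw 0) (Pw 1)) ->
  m <= p.
Proof.
  intros Hm H. pose proof (chain_residuated m Hm) as HL.
  apply (le_rl_lambda HL) in H.
  - rewrite chain_exp_Pw in H. apply chain_leE in H. simpl in H. lia.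
  - apply (rl_exp_le_e HL), chain_leE. simpl. lia.
Qed.

Lemma Hclass_sub_fst (m n p q : nat) :
  1 <= m -> 1 <= n -> class_sub (Hclass m n) (Hclass p q) -> m <= p.
Proof.
  intros Hm Hn Hsub. apply (chain_lambda_sharp m p Hm).
  assert (H : Hclass p q (chain_rl m)).
  { apply Hsub, (Hclass_mono m 1); [lia | exact Hn |].
    apply chain_Hclass, Hm. }
  destruct H as [_ [Hl _]]. exact (Hl (Pw 1) (YPw 0)).
Qed.

Lemma Hclass_sub_snd (m n p q : nat) :
  1 <= m -> 1 <= n -> class_sub (Hclass m n) (Hclass p q) -> n <= q.
Proof.
  intros Hm Hn Hsub. apply (chain_lambda_sharp n q Hn).
  assert (H : Hclass p q (rl_op (chain_rl n))).
  { apply Hsub, (Hclass_mono 1 n); [exact Hm | lia |].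
    apply Hclass_op, chain_Hclass, Hn. }
  (* The double opposite is the chain itself up to conversion, with the indices [p] and [q]
     exchanged. *)
  destruct (Hclass_op _ _ _ H) as [_ [Hl _]]. exact (Hl (Pw 1) (YPw 0)).
Qed.

(** * Principal convex subalgebras and products *)

(* For [x <= e], the convex subalgebra generated by [x]; the second inequality
   is [a <= x^k \ e]. *)
Definition principal_csub {L : rl_algebra} (x a : L) : Prop :=
  exists k, rl_le (rl_exp x k) a /\ rl_le (rl_mul (rl_exp x k) a) rl_e.

(** One power [u] of [x] bounds both elements. The equation for [u u] is recorded because products
    and residuals need the square as their witness. *)
Lemma principal_csub_common {L} (HL : residuated_lattice L) (x a b : L) :
  rl_le x rl_e -> principal_csub x a -> principal_csub x b ->
  exists u : L, exists k, u = rl_exp x k /\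
    rl_mul u u = rl_exp x (k + k) /\
    (rl_le u a /\ rl_le (rl_mul u a) rl_e) /\
    (rl_le u b /\ rl_le (rl_mul u b) rl_e).
Proof.
  intros Hx (i & Hia & Hae) (j & Hjb & Hbe).
  exists (rl_exp x (i + j)), (i + j).
  assert (Hi : rl_le (rl_exp x (i + j)) (rl_exp x i))
    by (apply (rl_exp_anti HL); [exact Hx | lia]).
  assert (Hj : rl_le (rl_exp x (i + j)) (rl_exp x j))
    by (apply (rl_exp_anti HL); [exact Hx | lia]).
  split; [reflexivity|].
  split; [symmetry; apply (rl_exp_add HL)|].
  repeat split.
  - apply (rl_le_trans HL _ _ _ Hi Hia).
  - apply (rl_le_trans HL _ _ _ (rl_mul_monol HL _ _ _ Hi) Hae).
  - apply (rl_le_trans HL _ _ _ Hj Hjb).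
  - apply (rl_le_trans HL _ _ _ (rl_mul_monol HL _ _ _ Hj) Hbe).
Qed.

Lemma principal_csub_convex {L : rl_algebra} (x : L) :
  e_cyclic_rl L -> rl_le x rl_e -> convex_subalgebra (principal_csub x).
Proof.
  intros [HL HC] Hx. pose proof (proj1 (e_cyclic_mul HL) HC) as HC'.
  pose proof (rl_le_trans HL) as tr.
  constructor.
  - exists 0. simpl. rewrite (rl_mul1l HL). split; apply (rl_le_refl HL).
  - intros a b Ha Hb.
    destruct (principal_csub_common HL x a b Hx Ha Hb)
      as (u & k & Hu & Huu & [Hua Hae] & [Hub Hbe]).
    exists (k + k). rewrite <- Huu. split.
    + apply (rl_mul_mono HL); assumption.
    + rewrite <- (rl_mulA HL).
      apply (tr (rl_mul u b)); [|exact Hbe].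
      apply (rl_mul_monor HL).
      rewrite (rl_mulA HL). apply (rl_mul_decrl HL), Hae.
  - intros a b Ha Hb.
    destruct (principal_csub_common HL x a b Hx Ha Hb)
      as (u & k & Hu & Huu & [Hua Hae] & [Hub Hbe]).
    exists (k + k). rewrite <- Huu. split.
    (* Here [a u u <= u <= b]; e-cyclicity supplies [a u <= e] from [u a <= e]. *)
    + apply (proj1 (rl_ldivP HL _ _ _)). rewrite (rl_mulA HL).
      apply (tr u); [|exact Hub].
      apply (rl_mul_decrl HL), HC', Hae.
    + rewrite <- (rl_mulA HL). apply (tr (rl_mul u b)); [|exact Hbe].
      apply (rl_mul_monor HL), (tr (rl_mul a (rl_ldiv a b))).
      * apply (rl_mul_monol HL), Hua.
      * apply (rl_mul_ldiv HL).
  - intros b a Hb Ha.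
    destruct (principal_csub_common HL x a b Hx Ha Hb)
      as (u & k & Hu & Huu & [Hua Hae] & [Hub Hbe]).
    exists (k + k). rewrite <- Huu. split.
    + apply (proj1 (rl_rdivP HL _ _ _)). rewrite <- (rl_mulA HL).
      apply (tr u); [|exact Hub].
      apply (rl_mul_decrr HL), Hae.
    (* The quotient [b/a] cancels against a factor on its right, so e-cyclicity first moves [u u]
       there; then [(b/a) u <= (b/a) a <= b] and [b u <= e]. *)
    + apply HC'. rewrite (rl_mulA HL).
      apply (tr (rl_mul b u)); [|apply HC', Hbe].
      apply (rl_mul_monol HL), (tr (rl_mul (rl_rdiv b a) a)).
      * apply (rl_mul_monor HL), Hua.
      * apply (rl_mul_rdiv HL).
  - intros a b Ha Hb.
    destruct (principal_csub_common HL x a b Hx Ha Hb)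
      as (u & k & Hu & Huu & [Hua Hae] & [Hub Hbe]).
    exists k. rewrite <- Hu. split.
    + apply (tr a); [exact Hua | apply (rl_le_joinl HL)].
    + apply (rl_ldivP HL), (rl_join_le HL); apply (rl_ldivP HL); assumption.
  - intros a b Ha Hb.
    destruct (principal_csub_common HL x a b Hx Ha Hb)
      as (u & k & Hu & Huu & [Hua Hae] & [Hub Hbe]).
    exists k. rewrite <- Hu. split.
    + apply (rl_le_meet HL). split; assumption.
    + apply (tr (rl_mul u a)); [|exact Hae].
      apply (rl_mul_monor HL), (rl_meet_lel HL).
  - intros a c b Ha Hb Hac Hcb.
    destruct (principal_csub_common HL x a b Hx Ha Hb)
      as (u & k & Hu & Huu & [Hua Hae] & [Hub Hbe]).
    exists k. rewrite <- Hu. split.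
    + apply (tr a); assumption.
    + apply (tr (rl_mul u b)); [|exact Hbe].
      apply (rl_mul_monor HL), Hcb.
Qed.

(** Normality puts the conjugate into the convex subalgebra generated by [x]. The exponent may
    depend on [x] and [y], but in a product it must serve all coordinates at once. *)
Lemma hamiltonian_exp_le_lambda {L : rl_algebra} (x y : L) :
  e_cyclic_rl L -> hamiltonian L -> rl_le x rl_e ->
  exists k, rl_le (rl_exp x k) (rl_lambda y x).
Proof.
  intros HL Hham Hx.
  assert (Hxx : principal_csub x x).
  { destruct HL as [HL _]. exists 1. simpl. rewrite (rl_mul1r HL). split.
    - apply (rl_le_refl HL).
    - apply (rl_le_trans HL x); [apply (rl_mul_decrr HL)|]; exact Hx. }
  destruct (Hham _ (principal_csub_convex x HL Hx) x y Hxx) as [(k & Hk & _) _].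
  exists k. exact Hk.
Qed.

Definition rl_prod {I : Type} (A : I -> rl_algebra) : rl_algebra :=
  @RLAlgebra (forall i, A i)
    (fun x y i => rl_mul (x i) (y i)) (fun x y i => rl_ldiv (x i) (y i))
    (fun x y i => rl_rdiv (x i) (y i)) (fun x y i => rl_join (x i) (y i))
    (fun x y i => rl_meet (x i) (y i)) (fun i => rl_e).

Lemma rl_prod_eval {I : Type} (A : I -> rl_algebra)
  (v : nat -> rl_prod A) (t : rl_term) (i : I) :
  rl_eval v t i = rl_eval (fun k => v k i) t.
Proof.
  induction t; simpl; rewrite ?IHt1, ?IHt2; reflexivity.
Qed.

Lemma rl_prod_exp {I : Type} (A : I -> rl_algebra)
  (x : rl_prod A) (k : nat) (i : I) :
  rl_exp x k i = rl_exp (x i) k.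
Proof. induction k as [|k IH]; simpl; [|rewrite IH]; reflexivity. Qed.

(** Terms evaluate coordinatewise; functional extensionality turns this into the Leibniz equality
    that identities demand. *)
Lemma variety_prod {I : Type} (A : I -> rl_algebra) (K : rl_class) :
  variety K -> (forall i, K (A i)) -> K (rl_prod A).
Proof.
  intros [E HE] HA. apply HE. intros s t Hst v.
  apply functional_extensionality_dep. intros i. rewrite !rl_prod_eval.
  apply (proj1 (HE (A i)) (HA i) _ _ Hst).
Qed.

Lemma chain_prod_not_hamiltonian :
  e_cyclic_rl (rl_prod (fun k => chain_rl (S k))) ->
  ~ hamiltonian (rl_prod (fun k => chain_rl (S k))).
Proof.
  intros HP Hham.
  pose (x := (fun _ => Pw 1) : rl_prod (fun k => chain_rl (S k))).
  pose (y := (fun _ => YPw 0) : rl_prod (fun k => chain_rl (S k))).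
  assert (Hx : rl_le x rl_e) by reflexivity.
  destruct (hamiltonian_exp_le_lambda x y HP Hham Hx) as [k Hk].
  (* Coordinate [k] carries the chain of parameter [S k], where sharpness would give [S k <= k]. *)
  apply (f_equal (fun f => f k)) in Hk.
  change (rl_le (rl_exp x k k) (rl_lambda (y k) (x k))) in Hk.
  rewrite rl_prod_exp in Hk.
  apply (chain_lambda_sharp (S k)) in Hk; lia.
Qed.

Lemma no_largest_hamiltonian_variety :
  ~ (exists V : rl_class, hamiltonian_variety V /\
       forall W : rl_class, hamiltonian_variety W -> class_sub W V).
Proof.
  intros (V & (HV & HVc & HVh) & Hmax).
  (* Membership in [V] also yields the e-cyclicity and residuation of the product. *)
  assert (HP : V (rl_prod (fun k => chain_rl (S k)))).
  { apply (variety_prod _ _ HV). intros k.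
    apply (Hmax _ (Hclass_hamiltonian_variety (S k) 1)).
    apply chain_Hclass. lia. }
  exact (chain_prod_not_hamiltonian (HVc _ HP) (HVh _ HP)).
Qed.

Theorem theorem6p3 :
  (forall m n : nat, 1 <= m -> 1 <= n -> hamiltonian_variety (Hclass m n)) /\
  (forall m n p q : nat, 1 <= m -> 1 <= n -> 1 <= p -> 1 <= q ->
     (m <= p /\ n <= q <-> class_sub (Hclass m n) (Hclass p q))) /\
  ~ (exists V : rl_class, hamiltonian_variety V /\
       forall W : rl_class, hamiltonian_variety W -> class_sub W V).
Proof.
  split; [|split].
  - intros m n _ _. apply Hclass_hamiltonian_variety.
  - intros m n p q Hm Hn _ _. split.
    + intros [Hmp Hnq]. apply Hclass_mono; assumption.
    + intros Hsub. split.
      * apply (Hclass_sub_fst m n p q Hm Hn Hsub).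
      * apply (Hclass_sub_snd m n p q Hm Hn Hsub).
  - apply no_largest_hamiltonian_variety.
Qed.
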